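(* Let $\mathfrak{b}$ be an $\epsilon$-$\delta$ sequence for $\mathfrak{gl}(m|n)$ (a choice of Borel subalgebra), and let $\lambda$ be an $(m|n)$-hook partition. The module $L_{m|n}(\mathfrak{b},\lambda^{\mathfrak{b}})$ has a basis indexed by the $\mathfrak{b}$-semistandard tableaux of shape $\lambda$, which is obtained by iterated application of the branching rule (recalled in the context). The entries of the tableau determine which simple summand the corresponding basis vector belongs to at each application of the branching rule.
   Context: The ground field is $\mathbb{C}$. Partitions are identified with their Young diagrams; $\lambda'$ is the conjugate partition. $\lambda$ is an $(m|n)$-hook partition if $\lambda_{m+1}\le n$. A partition $\mu$ interlaces $\lambda$ if $\lambda_i\ge\mu_i\ge\lambda_{i+1}$ for all $i$. $\mathfrak{gl}(m|n)$ is the Lie superalgebra of $(m+n)\times(m+n)$ complex matrices with even part the block-diagonal matrices $\mathfrak{gl}(m)\oplus\mathfrak{gl}(n)$; $\mathfrak{h}$ is the Cartan subalgebra of diagonal matrices with basis $h_i=E_{ii}$ and dual basis $\delta_1,\dots,\delta_m,\epsilon_1,\dots,\epsilon_n$ of $\mathfrak{h}^*$ ($\delta_i$ dual to $h_i$, $\epsilon_j$ dual to $h_{m+j}$). The roots are the differences of two distinct elements of $\{\delta_1,\dots,\delta_m,\epsilon_1,\dots,\epsilon_n\}$. An $\epsilon$-$\delta$ sequence for $\mathfrak{gl}(m|n)$ is a sequence $\mathfrak{b}$ of $m$ symbols $\delta$ and $n$ symbols $\epsilon$. Label the $\delta$'s as $\delta_1,\dots,\delta_m$ and the $\epsilon$'s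 as $\epsilon_1,\dots,\epsilon_n$ in order of appearance; the positive roots are all differences $x-y$ with $x$ appearing before $y$. The corresponding Borel subalgebra, also denoted $\mathfrak{b}$, is the sum of $\mathfrak{h}$ and the positive root spaces. For $\omega\in\mathfrak{h}^*$, $L_{m|n}(\mathfrak{b},\omega)$ is the simple $\mathfrak{gl}(m|n)$-module of highest weight $\omega$ with respect to $\mathfrak{b}$. For an $(m|n)$-hook partition $\lambda$, with $d_i$ the number of $\epsilon$'s before the $i$-th $\delta$ in $\mathfrak{b}$ and $e_j$ the number of $\delta$'s before the $j$-th $\epsilon$ in $\mathfrak{b}$, \[ \lambda^{\mathfrak{b}}=\sum_{i=1}^m\max\{\lambda_i-d_i,0\}\,\delta_i+\sum_{j=1}^n\max\{\lambda'_j-e_j,0\}\,\epsilon_j . \] Branching rule: let $\hat{\mathfrak{b}}$ be obtained from $\mathfrak{b}$ by deleting its last entry, and let $\hat m$, $\hat n$ be the numbers of $\delta$'s and $\epsilon$'s in $\hat{\mathfrak{b}}$. Embed $\mathfrak{gl}(\hat m|\hat n)$ in $\mathfrak{gl}(m|n)$ as the span of the elementary matrices $E_{ab}$ with $a,b\in\{1,\dots,\hat m\}\cup\{m+1,\dots,m+\hat n\}$. Then, on restriction to $\mathfrak{gl}(\hat m|\hat n)$, \[ L_{m|n}(\mathfrak{b},\lambda^{\mathfrak{b}})\cong\bigoplus_{\sigma}L_{\hat m|\hat n}(\hat{\mathfrak{b}},\sigma^{\hat{\mathfrak{b}}}), \] the sum being over all $(\hat m|\hat n)$-hook partitions $\sigma$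 such that $\sigma'$ interlaces $\lambda'$ if $\hat m=m$, and such that $\sigma$ interlaces $\lambda$ if $\hat n=n$. Iterating means applying the rule again to each summand, with $\hat{\mathfrak{b}}$ in place of $\mathfrak{b}$, and so on. Tableaux: let $A=\{1,\dots,m,\bar 1,\dots,\bar n\}$. Let $<_{\mathfrak{b}}$ be the total order on $A$ obtained by letting $i$ correspond to the $i$-th $\delta$ of $\mathfrak{b}$ and $\bar j$ to the $j$-th $\epsilon$ of $\mathfrak{b}$, and ordering letters by their positions in $\mathfrak{b}$ (earlier position means smaller). A $\mathfrak{b}$-semistandard tableau of shape $\lambda$ is a filling of the Young diagram of $\lambda$ with entries in $A$ such that: (1) entries are weakly increasing along each row and each column with respect to $<_{\mathfrak{b}}$; (2) entries from $\{1,\dots,m\}$ are strictly increasing along each column; (3) entries from $\{\bar 1,\dots,\bar n\}$ are strictly increasing along each row. *)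

(* Defs.v *)
(* The ground field is R[i] for R : realType. *)
From HB Require Import structures.
From mathcomp Require Import all_boot all_order all_algebra.
From mathcomp Require Import boolp classical_sets reals.
From mathcomp Require Import complex.

Set Implicit Arguments.
Unset Strict Implicit.
Unset Printing Implicit Defensive.

Import Order.TTheory GRing.Theory Num.Theory.
Local Open Scope classical_set_scope.
Local Open Scope ring_scope.

(** * Partitions *)

(* A partition is the list of its nonzero parts; lam_(i+1) is nth 0 lam i. *)
Definition is_part (lam : seq nat) : bool :=
  sorted geq lam && (0%N \notin lam).

Definition conj_part (lam : seq nat) : seq nat :=
  mkseq (fun j => count (fun x => (j < x)%N) lam) (head 0%N lam).

Definition hook (m n : nat) (lam : seq nat) : bool := (nth 0 lam m <= n)%N.

Definition interlaces (mu lam : seq nat) : Prop :=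
  forall i, (nth 0 mu i <= nth 0 lam i)%N /\ (nth 0 lam i.+1 <= nth 0 mu i)%N.

(** * Epsilon-delta sequences *)

(* An epsilon-delta sequence is a [seq bool]: false stands for delta and true
   for epsilon. It is a sequence for gl(ndelta b | neps b). *)
Definition ndelta (b : seq bool) : nat := count negb b.
Definition neps (b : seq bool) : nat := count id b.

(* Indices a : 'I_(m + n), with m = ndelta b and n = neps b, play three roles:
   rows/columns of matrices, the elements delta_1, .., delta_m, epsilon_1, ..,
   epsilon_n of the dual basis, and the letters 1, .., m, bar 1, .., bar n.
   [pos b a] is the position in b of the symbol attached to a, so that
   a <_b a' iff pos b a < pos b a', iff E_(a, a') is a positive root vector. *)
Definition positions (s : bool) (b : seq bool) : seq nat :=
  [seq k <- iota 0 (size b) | nth false b k == s].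

Definition pos (b : seq bool) (a : nat) : nat :=
  nth 0%N (positions false b ++ positions true b) a.

Definition trunc (b : seq bool) : seq bool := take (size b).-1 b.

(* The index set of the branching rule for the pair (b, lam). *)
Definition branches (b : seq bool) (lam : seq nat) : set (seq nat) :=
  [set sigma | [/\ is_part sigma,
    hook (ndelta (trunc b)) (neps (trunc b)) sigma,
    ndelta (trunc b) = ndelta b -> interlaces (conj_part sigma) (conj_part lam)
    & neps (trunc b) = neps b -> interlaces sigma lam]].

(** * The Lie superalgebra gl(m|n) and its modules *)

Section Modules.
Variable R : realType.
Notation C := (R[i]).

Definition gl_homog (m n : nat) (s : bool) : set 'M[C]_(m + n) :=
  [set X : 'M[C]_(m + n) | forall a c : 'I_(m + n),
     X a c != 0 -> (m <= a)%N (+) (m <= c)%N = s].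

(* The superbracket of X and Y, homogeneous of parities s and t. *)
Definition sbracket (m n : nat) (s t : bool) (X Y : 'M[C]_(m + n)) :
  'M[C]_(m + n) := X *m Y - (-1) ^+ (s && t) *: (Y *m X).

Definition subspace (V : lmodType C) (U : set V) : Prop :=
  U 0 /\ forall (k : C) u v, U u -> U v -> U (k *: u + v).

Record glmodule (m n : nat) := GlModule {
  gl_carrier :> lmodType C;
  homog : bool -> set gl_carrier;
  act : 'M[C]_(m + n) -> gl_carrier -> gl_carrier;
  homog_subspace : forall s, subspace (homog s);
  homog_split : forall v : gl_carrier, exists! u : gl_carrier * gl_carrier,
    [/\ homog false u.1, homog true u.2 & v = u.1 + u.2];
  act_linear : forall X, linear (act X);
  act_linearl : forall v, linear (act^~ v);
  act_homog : forall s t X v,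
    gl_homog s X -> homog t v -> homog (s (+) t) (act X v);
  act_bracket : forall s t X Y v, gl_homog s X -> gl_homog t Y ->
    act (sbracket s t X Y) v
      = act X (act Y v) - (-1) ^+ (s && t) *: act Y (act X v) }.

Definition submodule (m n : nat) (M : glmodule m n) (U : set M) : Prop :=
  [/\ subspace U,
      (forall v, U v -> exists v0 v1,
         [/\ homog false v0, homog true v1, v = v0 + v1, U v0 & U v1])
    & (forall X v, U v -> U (act X v))].

Definition simple_module (m n : nat) (M : glmodule m n) : Prop :=
  (exists v : M, v != 0) /\
  forall U : set M, submodule U -> U = [set 0] \/ U = setT.

(* A weight is the row vector of its coordinates on delta_1, .., epsilon_n.
   [is_L b w M] says that M is L(b, w), which is thus defined up to
   isomorphism and parity shift. *)
Definition is_L (b : seq bool) (w : 'rV[C]_(ndelta b + neps b))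
    (M : glmodule (ndelta b) (neps b)) : Prop :=
  simple_module M /\
  exists v : M, [/\ v != 0,
    (forall a c : 'I_(ndelta b + neps b),
       (pos b a < pos b c)%N -> act (delta_mx a c) v = 0)
    & (forall a, act (delta_mx a a) v = w 0 a *: v)].
Arguments is_L b w M : clear implicits.

(* The weight lam^b; truncated subtraction provides the max with 0. *)
Definition hwt (b : seq bool) (lam : seq nat) :
    'rV[C]_(ndelta b + neps b) :=
  \row_a (match split a with
          | inl i => nth 0%N lam i - neps (take (pos b a) b)
          | inr j => nth 0%N (conj_part lam) j - ndelta (take (pos b a) b)
          end)%N%:R.

(* For p <= m and q <= n, the embedding of gl(p|q) in gl(m|n) that sends
   E_(a, c) to E_(i a, i c), where i maps the first p indices to 0, .., p - 1
   and the last q indices to m, .., m + q - 1. *)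
Definition gl_incl (p q m n : nat) : 'M[C]_(m + n, p + q) :=
  block_mx (pid_mx p) 0 0 (pid_mx q).

Definition gl_emb (p q m n : nat) (X : 'M[C]_(p + q)) : 'M[C]_(m + n) :=
  gl_incl p q m n *m X *m (gl_incl p q m n)^T.

(* Even homomorphisms of gl(p|q)-modules from L to the restriction of M. *)
Definition res_hom (p q m n : nat) (L : glmodule p q) (M : glmodule m n)
    (f : L -> M) : Prop :=
  [/\ linear f, (forall s x, homog s x -> homog s (f x))
    & (forall X x, f (act X x) = act (gl_emb m n X) (f x))].

(* U is a submodule of the restriction of M to gl(ndelta b | neps b), and it is
   isomorphic to L(b, mu^b). *)
Definition is_L_sub (m n : nat) (M : glmodule m n) (b : seq bool)
    (mu : seq nat) (U : set M) : Prop :=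
  exists L : glmodule (ndelta b) (neps b), is_L b (hwt b mu) L /\
  exists f : L -> M, [/\ res_hom f, injective f & range f = U].

Definition direct_sum (V : lmodType C) (I : eqType) (D : set I)
    (U : I -> set V) (W : set V) : Prop :=
  [/\ (forall i, D i -> U i `<=` W),
      (forall w, W w -> exists (s : seq I) (u : I -> V),
         [/\ uniq s, (forall i, i \in s -> D i /\ U i (u i))
           & w = \sum_(i <- s) u i])
    & (forall (s : seq I) (u : I -> V), uniq s ->
         (forall i, i \in s -> D i /\ U i (u i)) ->
         \sum_(i <- s) u i = 0 -> forall i, i \in s -> u i = 0)].

(* W is the direct sum of submodules U sigma isomorphic to
   L(trunc b, sigma^(trunc b)), for sigma in the index set of the branching
   rule for (b, lam). *)
Definition branching_decomposition (m n : nat) (M : glmodule m n)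
    (b : seq bool) (lam : seq nat) (U : seq nat -> set M) (W : set M) : Prop :=
  direct_sum (branches b lam) U W /\
  forall sigma, branches b lam sigma -> is_L_sub (trunc b) sigma (U sigma).

Definition branching_rule : Prop :=
  forall (b : seq bool) (lam : seq nat) (M : glmodule (ndelta b) (neps b)),
    (0 < size b)%N -> is_part lam -> hook (ndelta b) (neps b) lam ->
    is_L b (hwt b lam) M ->
    exists U : seq nat -> set M, branching_decomposition b lam U setT.

(** * Iterated branching *)

(* A chain c = [:: sigma_1; ..; sigma_r] records the summands chosen in the
   first r applications of the branching rule, starting from lam. *)
Definition valid_chain (b : seq bool) (lam : seq nat) (c : seq (seq nat)) :
    Prop :=
  forall r, (r < size c)%N ->
    branches (take (size b - r) b) (nth [::] (lam :: c) r) (nth [::] c r).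

(* U c is the simple summand of M reached along the chain c. *)
Definition iterated_branching (b : seq bool) (lam : seq nat)
    (M : glmodule (ndelta b) (neps b)) (U : seq (seq nat) -> set M) : Prop :=
  U [::] = setT /\
  forall c, valid_chain b lam c -> (size c < size b)%N ->
    branching_decomposition (take (size b - size c) b) (last lam c)
      (fun sigma => U (rcons c sigma)) (U c).

Definition is_basis (V : lmodType C) (I : finType) (v : I -> V) : Prop :=
  forall w, exists! k : {ffun I -> C}, w = \sum_i k i *: v i.

End Modules.

Arguments is_L {R} b w M.
Arguments iterated_branching {R} b lam M U.
Arguments hwt {R} b lam.

(** * Tableaux *)

Section Tableaux.
Local Open Scope nat_scope.
Variables (b : seq bool) (lam : seq nat).

Definition box : finType :=
  {x : 'I_(size lam) * 'I_(head 0 lam) | x.2 < nth 0 lam x.1}.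
Definition row_of (x : box) : nat := (val x).1.
Definition col_of (x : box) : nat := (val x).2.

Definition filling : finType := {ffun box -> 'I_(ndelta b + neps b)}.

Definition semistandard (T : filling) : bool :=
  [forall x, forall y,
    [&& (row_of x == row_of y) && (col_of x <= col_of y)
          ==> (pos b (T x) <= pos b (T y)),
        (col_of x == col_of y) && (row_of x <= row_of y)
          ==> (pos b (T x) <= pos b (T y)),
        [&& col_of x == col_of y, row_of x < row_of y,
            T x < ndelta b & T y < ndelta b]
          ==> (pos b (T x) < pos b (T y))
      & [&& row_of x == row_of y, col_of x < col_of y,
            ndelta b <= T x & ndelta b <= T y]
          ==> (pos b (T x) < pos b (T y))]].

Definition sstableau : finType := {T : filling | semistandard T}.

(* The row lengths of the set of boxes whose entry is one of the k smallest
   letters. *)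
Definition subshape (T : sstableau) (k : nat) : seq nat :=
  [seq l <- mkseq (fun i => #|[set x : box |
                       (row_of x == i) && (pos b (val T x) < k)]|) (size lam)
  | 0 < l].

(* The shapes left after deleting the largest letter, the two largest letters,
   .., the r largest letters. *)
Definition tableau_chain (T : sstableau) (r : nat) : seq (seq nat) :=
  mkseq (fun j => subshape T (size b - j.+1)) r.

End Tableaux.

(* Main.v *)
(* Write (i, j) for the box in row i and column j. Removing the largest letter
   of a semistandard tableau removes a horizontal strip if the letter is a
   delta and a vertical strip if it is an epsilon, and these are the two
   interlacing conditions of the branching rule: beyond the inclusion of sigma
   in lam, they say that (i + 1, j) in lam implies (i, j) in sigma, resp. that
   (i, j + 1) in lam implies (i, j) in sigma. The hook condition on sigma is
   then automatic, by induction on the number of letters, so a tableau is the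
   same thing as a full chain of choices of summands, the letter of a box
   being read off from the step at which the box appears. On the module side,
   the branching rule is transported along the embeddings of the summands, and
   composing the decompositions writes M as the direct sum of the U c over
   full chains c. Such a U c is a simple gl(0|0)-module, hence a line, because
   every homogeneous vector spans a submodule. *)

Require Import Defs.
From HB Require Import structures.
From mathcomp Require Import all_boot all_order all_algebra.
From mathcomp Require Import boolp classical_sets reals.
From mathcomp Require Import complex.

Set Implicit Arguments.
Unset Strict Implicit.
Unset Printing Implicit Defensive.

Import GRing.Theory.

(** * Partitions and interlacing, read box by box *)

Lemma geq_trans : transitive geq.
Proof. by move=> y x z /= le_yx le_zy; exact: leq_trans le_zy le_yx. Qed.

Lemma nth_part_le lam i j : is_part lam -> i <= j -> nth 0 lam j <= nth 0 lam i.
Proof.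
case/andP=> slam _ le_ij; have [lt_j|ge_j] := ltnP j (size lam); last first.
  by rewrite (nth_default _ ge_j).
apply: (sorted_leq_nth geq_trans leqnn 0 slam) => //.
exact: leq_ltn_trans le_ij lt_j.
Qed.

Lemma nth_part_gt0 lam i : is_part lam -> (0 < nth 0 lam i) = (i < size lam).
Proof.
case/andP=> _ lam0; have [lt_i|ge_i] := ltnP i (size lam); last first.
  by rewrite nth_default.
by rewrite lt0n; apply: contraNneq lam0 => <-; exact: mem_nth.
Qed.

Lemma part_ext lam mu : is_part lam -> is_part mu ->
  (forall i j, (j < nth 0 lam i) = (j < nth 0 mu i)) -> lam = mu.
Proof.
move=> plam pmu E.
have nthE i : nth 0 lam i = nth 0 mu i.
  apply/eqP; rewrite eqn_leq; apply/andP; split; rewrite leqNgt.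
    by rewrite E ltnn.
  by rewrite -E ltnn.
have sizeE : size lam = size mu.
  apply/eqP; rewrite eqn_leq; apply/andP; split; rewrite leqNgt -nth_part_gt0 //.
    by rewrite nthE nth_part_gt0 // ltnn.
  by rewrite -nthE nth_part_gt0 // ltnn.
exact: (@eq_from_nth _ 0).
Qed.

(** A downward closed predicate bounded by [N] cuts out an initial segment, whose length is the
    count. This turns row and column lengths into membership of boxes. *)
Lemma ltn_count_iota (g : pred nat) N :
  (forall i j, i <= j -> g j -> g i) -> (forall i, g i -> i < N) ->
  forall j, (j < count g (iota 0 N)) = g j.
Proof.
elim: N g => [|N IHN] g gdown gN j.
  by apply/esym/negbTE/negP => /gN.
(* Split off 0 and shift: the induction hypothesis is applied to [fun i => g i.+1]. *)
rewrite /= (iotaDl 1 0) count_map.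
case: (boolP (g 0)) => g0; last first.
  have gF i : g i = false by apply/negbTE/(contra _ g0)/gdown.
  by rewrite gF (eq_count (a2 := pred0)) ?count_pred0 // => i /=; rewrite gF.
case: j => [|j]; first by rewrite g0.
rewrite add1n ltnS IHN // => [i k le_ik|i]; first exact: (gdown i.+1 k.+1).
by move=> /gN.
Qed.

(** For [j] below the first part, the predicate [j < nth 0 lam i] is downward closed in [i], so
    [ltn_count_iota] applies; for larger [j] both sides are false. *)
Lemma ltn_nth_conj_part lam i j : is_part lam ->
  (i < nth 0 (conj_part lam) j) = (j < nth 0 lam i).
Proof.
move=> plam; have countE : count (fun x => j < x) lam =
    count (fun i => j < nth 0 lam i) (iota 0 (size lam)).
  by rewrite -[in LHS](mkseq_nth 0 lam) /mkseq count_map.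
have [lt_j|ge_j] := ltnP j (head 0 lam).
  rewrite nth_mkseq // countE.
  rewrite (ltn_count_iota (g := fun i => j < nth 0 lam i)) // => [k l le_kl|k].
    by move=> /leq_trans -> //; exact: nth_part_le.
  by rewrite -nth_part_gt0 //; exact: leq_ltn_trans.
rewrite nth_default ?size_mkseq // ltn0; apply/esym/negbTE.
by rewrite -leqNgt (leq_trans (nth_part_le plam (leq0n i))) // nth0.
Qed.

Lemma leq_ltnP m n : (forall k, k < m -> k < n) <-> m <= n.
Proof.
split=> [H|le_mn k /leq_trans -> //].
by case: m H => // m; exact.
Qed.

Lemma interlacesP sigma lam : interlaces sigma lam <->
  (forall i j, j < nth 0 sigma i -> j < nth 0 lam i) /\
  (forall i j, j < nth 0 lam i.+1 -> j < nth 0 sigma i).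
Proof.
split=> [H|[H1 H2] i]; last by split; apply/leq_ltnP; [exact: H1|exact: H2].
by split=> i; have [H1 H2] := H i; exact/leq_ltnP.
Qed.

(** Transposition moves the shift by one from the row index to the column index. *)
Lemma interlaces_conjP sigma lam : is_part sigma -> is_part lam ->
  interlaces (conj_part sigma) (conj_part lam) <->
  (forall i j, j < nth 0 sigma i -> j < nth 0 lam i) /\
  (forall i j, j.+1 < nth 0 lam i -> j < nth 0 sigma i).
Proof.
move=> ps pl; rewrite interlacesP.
by split=> -[H1 H2]; split=> i j; move: (H1 j i) (H2 j i);
  rewrite !ltn_nth_conj_part.
Qed.

(** In a weakly decreasing list the zeros come last, and the default value 0 stands in for them once
    they are deleted. *)
Lemma nth_filter_gt0 s i :
  sorted geq s -> nth 0 [seq l <- s | 0 < l] i = nth 0 s i.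
Proof.
elim: s i => [|x s IHs] i; first by rewrite /= nth_nil.
move=> ss; have ss' := path_sorted ss; rewrite /=.
case: posnP => [x0|_]; last first.
  by case: i => //= i; exact: IHs.
rewrite x0 in ss *; have -> : s = nseq (size s) 0.
  apply/all_pred1P/allP => y ys /=.
  by have /allP/(_ y ys) := order_path_min geq_trans ss; rewrite /= leqn0.
have -> : [seq l <- nseq (size s) 0 | 0 < l] = [::].
  by apply/eqP; rewrite -[_ == _]negbK -has_filter has_nseq andbF.
by rewrite nth_nil; case: i => //= i; rewrite nth_nseq if_same.
Qed.

(** * Positions *)

Lemma ndelta_neps b : ndelta b + neps b = size b.
Proof. by rewrite addnC count_predC. Qed.

Lemma size_positions s b : size (positions s b) = count (pred1 s) b.
Proof. by rewrite size_filter -[in RHS](mkseq_nth false b) /mkseq count_map. Qed.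

Lemma size_positionsF b : size (positions false b) = ndelta b.
Proof. by rewrite size_positions; apply: eq_count => -[]. Qed.

Lemma size_positionsT b : size (positions true b) = neps b.
Proof. by rewrite size_positions; apply: eq_count => -[]. Qed.

Lemma mem_positions s b k :
  (k \in positions s b) = (k < size b) && (nth false b k == s).
Proof. by rewrite mem_filter mem_iota andbC. Qed.

(** This makes [pos b] a bijection from the letters to the positions of [b]. *)
Lemma all_positions_perm b :
  perm_eq (positions false b ++ positions true b) (iota 0 (size b)).
Proof.
rewrite perm_sym -(perm_filterC (fun k => nth false b k == false)) perm_cat2l.
by apply/permP => a; rewrite !count_filter; apply: eq_count => k /=; case: nth.
Qed.

Lemma pos_lt b a : a < size b -> pos b a < size b.
Proof.
move=> lt_a; have := perm_mem (all_positions_perm b) (pos b a).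
rewrite mem_iota /= add0n => <-.
by apply: mem_nth; rewrite (perm_size (all_positions_perm b)) size_iota.
Qed.

Lemma pos_inj b : {in gtn (size b) &, injective (pos b)}.
Proof.
move=> a c lta ltc /eqP; rewrite nth_uniq => [/eqP//|||].
- by rewrite (perm_size (all_positions_perm b)) size_iota.
- by rewrite (perm_size (all_positions_perm b)) size_iota.
- by rewrite (perm_uniq (all_positions_perm b)) iota_uniq.
Qed.

Lemma pos_surj b k : k < size b -> exists2 a, a < size b & pos b a = k.
Proof.
move=> ltk; have : k \in positions false b ++ positions true b.
  by rewrite (perm_mem (all_positions_perm b)) mem_iota.
case/(nthP 0) => a; rewrite (perm_size (all_positions_perm b)) size_iota => lta.
by exists a.
Qed.

Lemma nth_pos b a : a < size b -> nth false b (pos b a) = (ndelta b <= a).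
Proof.
move=> lta; rewrite /pos nth_cat size_positionsF ltnNge.
case: (leqP (ndelta b) a) => /= le_a.
  have /(mem_nth 0) : a - ndelta b < size (positions true b).
    by rewrite size_positionsT ltn_subLR // ndelta_neps.
  by rewrite mem_positions => /andP[_ /eqP].
have /(mem_nth 0) : a < size (positions false b) by rewrite size_positionsF.
by rewrite mem_positions => /andP[_ /eqP].
Qed.

(** * Branching *)

Lemma trunc_take b k : k < size b -> trunc (take k.+1 b) = take k b.
Proof. by move=> ltk; rewrite /trunc size_takel //= take_takel. Qed.

Lemma trunc_take_sub b k :
  k < size b -> trunc (take (size b - k) b) = take (size b - k.+1) b.
Proof.
move=> ltk; rewrite -[size b - k]subnSK // trunc_take //.
by rewrite ltn_subrL (leq_ltn_trans _ ltk).
Qed.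

Lemma ndelta_takeS b k : k < size b ->
  ndelta (take k.+1 b) = ndelta (take k b) + ~~ nth false b k.
Proof.
by move=> ltk; rewrite (take_nth false) // /ndelta -cats1 count_cat /= addn0.
Qed.

Lemma neps_takeS b k : k < size b ->
  neps (take k.+1 b) = neps (take k b) + nth false b k.
Proof.
by move=> ltk; rewrite (take_nth false) // /neps -cats1 count_cat /= addn0.
Qed.

(** Deleting the last symbol lowers exactly one of the two counts, so exactly one of the conditional
    interlacing clauses is in force; the symbol at [k] selects it. *)
Lemma branchesP b k lam sigma : k < size b -> is_part lam ->
  branches (take k.+1 b) lam sigma <->
  [/\ is_part sigma, hook (ndelta (take k b)) (neps (take k b)) sigma,
      forall i j, j < nth 0 sigma i -> j < nth 0 lam i
    & forall i j, (if nth false b k then j.+1 < nth 0 lam i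
                   else j < nth 0 lam i.+1) -> j < nth 0 sigma i].
Proof.
move=> ltk plam; rewrite /branches /= trunc_take // ndelta_takeS // neps_takeS //.
case: (nth false b k) => /=; rewrite addn0.
  have neq m : m = m + 1 -> False by elim: m => // m IHm [/IHm].
  split=> [[ps h /(_ erefl) H _]|[ps h H1 H2]].
    by have [H1 H2] := (interlaces_conjP ps plam).1 H.
  by split=> // [_|/neq//]; apply/interlaces_conjP.
have neq m : m = m + 1 -> False by elim: m => // m IHm [/IHm].
split=> [[ps h _ /(_ erefl) /interlacesP[H1 H2]]|[ps h H1 H2]] //.
by split=> // [/neq//|_]; apply/interlacesP.
Qed.

(** * Tableaux *)

Lemma col_of_lt lam (x : box lam) : col_of x < nth 0 lam (row_of x).
Proof. exact: (valP x). Qed.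

Lemma box_at lam i j : is_part lam -> j < nth 0 lam i ->
  exists x : box lam, row_of x = i /\ col_of x = j.
Proof.
move=> plam ltj.
have lti : i < size lam by rewrite -nth_part_gt0 //; exact: leq_ltn_trans ltj.
have ltj0 : j < head 0 lam.
  by rewrite -nth0 (leq_trans ltj) // nth_part_le.
pose p := (Ordinal lti, Ordinal ltj0).
by exists (exist (fun p : 'I_(size lam) * 'I_(head 0 lam) =>
  p.2 < nth 0 lam p.1) p ltj).
Qed.

Lemma box_inj lam (x y : box lam) :
  row_of x = row_of y -> col_of x = col_of y -> x = y.
Proof.
move=> Er Ec; apply: val_inj.
rewrite [val x]surjective_pairing [val y]surjective_pairing.
by congr (_, _); apply: ord_inj.
Qed.

(* The set is a classical one, as in [subshape]. *)
Definition shape_of lam (A : pred (box lam)) : seq nat :=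
  [seq l <- mkseq (fun i => #|[set x : box lam | (row_of x == i) && A x]%classic|)
     (size lam) | 0 < l].

(** Within a row the column determines the box, so boxes can be counted by columns, the form that
    [ltn_count_iota] handles. *)
Lemma card_row lam (A : pred (box lam)) i :
  #|[set x : box lam | (row_of x == i) && A x]%classic| =
  count (fun j => [exists x : box lam, [&& row_of x == i, col_of x == j & A x]])
    (iota 0 (head 0 lam)).
Proof.
rewrite cardE -(size_map (@col_of lam)) -size_filter; apply: perm_size.
apply: uniq_perm => [||j].
- rewrite map_inj_in_uniq ?enum_uniq // => x y.
  rewrite !mem_enum !inE => /andP[/eqP rx _] /andP[/eqP ry _].
  by apply: box_inj; rewrite rx ry.
- by rewrite filter_uniq // iota_uniq.
rewrite mem_filter mem_iota /= add0n; apply/mapP/andP => [[x]|[/existsP[x]]].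
  rewrite mem_enum inE => /andP[rx Ax] ->; split; last exact: ltn_ord.
  by apply/existsP; exists x; rewrite rx eqxx.
case/and3P=> rx /eqP <- Ax _; exists x => //.
by rewrite mem_enum; apply/mem_set; rewrite /= rx.
Qed.

Section ShapeOf.
Variables (lam : seq nat) (A : pred (box lam)).
Hypothesis plam : is_part lam.
Hypothesis Adown : forall x y : box lam,
  row_of x <= row_of y -> col_of x <= col_of y -> A y -> A x.

Let inA i j := [exists x : box lam, [&& row_of x == i, col_of x == j & A x]].

Let inA_down i j k l : i <= k -> j <= l -> inA k l -> inA i j.
Proof.
move=> le_ik le_jl /existsP[y /and3P[/eqP ry /eqP cy Ay]].
have [|x [rx cx]] := @box_at lam i j plam.
  rewrite (leq_ltn_trans le_jl) // -cy (leq_trans (col_of_lt y)) // nth_part_le //.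
  by rewrite ry.
apply/existsP; exists x; rewrite rx cx !eqxx /=.
by apply: Adown Ay; rewrite ?rx ?cx ?ry ?cy.
Qed.

Let row_card i := #|[set x : box lam | (row_of x == i) && A x]%classic|.

Let ltn_row_card i j : (j < row_card i) = inA i j.
Proof.
rewrite /row_card card_row (ltn_count_iota (g := inA i)) // => [k l le_kl|k].
  exact: inA_down.
by case/existsP=> x /and3P[_ /eqP <- _]; exact: ltn_ord.
Qed.

Let sorted_row_card : sorted geq (mkseq row_card (size lam)).
Proof.
apply/(sortedP 0) => i; rewrite size_mkseq => lti.
rewrite !nth_mkseq //; last exact: ltnW.
by apply/leq_ltnP => j; rewrite !ltn_row_card; apply: inA_down.
Qed.

Lemma is_part_shape_of : is_part (shape_of A).
Proof.
by rewrite /is_part (sorted_filter geq_trans) ?sorted_row_card ?mem_filter.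
Qed.

Lemma ltn_nth_shape_of i j : (j < nth 0 (shape_of A) i) =
  [exists x : box lam, [&& row_of x == i, col_of x == j & A x]].
Proof.
rewrite nth_filter_gt0 ?sorted_row_card //.
have [lti|gei] := ltnP i (size lam); first by rewrite nth_mkseq // ltn_row_card.
rewrite nth_default ?size_mkseq //; apply/esym/negbTE/existsP => -[x].
case/and3P=> /eqP rx _ _; have := ltn_ord (val x).1.
by rewrite [nat_of_ord _]rx ltnNge gei.
Qed.

Lemma mem_shape_of (x : box lam) :
  (col_of x < nth 0 (shape_of A) (row_of x)) = A x.
Proof.
rewrite ltn_nth_shape_of; apply/existsP/idP => [[y]|Ax]; last first.
  by exists x; rewrite !eqxx.
by case/and3P=> /eqP ry /eqP cy; rewrite (box_inj ry cy).
Qed.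

Lemma shape_of_sub i j : j < nth 0 (shape_of A) i -> j < nth 0 lam i.
Proof.
rewrite ltn_nth_shape_of => /existsP[x /and3P[/eqP <- /eqP <- _]].
exact: col_of_lt.
Qed.

End ShapeOf.

(** * The chain of shapes of a tableau *)

Section Tableau.
Variables (b : seq bool) (lam : seq nat).
Hypothesis plam : is_part lam.

Lemma pos_letter_lt (a : 'I_(ndelta b + neps b)) : pos b a < size b.
Proof. by apply: pos_lt; rewrite -ndelta_neps. Qed.

(** Given weak growth, strictness fails only at equal positions, hence at equal letters by
    [pos_inj]. So the strict conditions say that a letter repeated in a column is an epsilon and a
    letter repeated in a row is a delta. *)
Lemma semistandardP (T : filling b lam) : reflect
  [/\ forall x y, row_of x = row_of y -> col_of x <= col_of y ->
        pos b (T x) <= pos b (T y),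
      forall x y, col_of x = col_of y -> row_of x <= row_of y ->
        pos b (T x) <= pos b (T y),
      forall x y, col_of x = col_of y -> row_of x < row_of y ->
        pos b (T x) = pos b (T y) -> nth false b (pos b (T x)) 
    & forall x y, row_of x = row_of y -> col_of x < col_of y ->
        pos b (T x) = pos b (T y) -> ~~ nth false b (pos b (T x))]
  (semistandard T).
Proof.
have lt x : T x < size b by rewrite -ndelta_neps.
apply: (iffP forallP) => [H|[H1 H2 H3 H4] x].
  split=> x y Exy.
  - move=> le_xy; have /forallP/(_ y)/and4P[/implyP-> //] := H x.
    by rewrite Exy eqxx.
  - move=> le_xy; have /forallP/(_ y)/and4P[_ /implyP-> //] := H x.
    by rewrite Exy eqxx.
  - move=> lt_xy Epos; have Tx := pos_inj (lt x) (lt y) Epos.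
    rewrite nth_pos // leqNgt; apply/negP => ltd.
    have /forallP/(_ y)/and4P[_ _ /implyP] := H x.
    by rewrite Exy eqxx lt_xy -Tx ltd ltnn => /(_ isT).
  move=> lt_xy Epos; have Tx := pos_inj (lt x) (lt y) Epos.
  rewrite nth_pos //; apply/negP => led.
  have /forallP/(_ y)/and4P[_ _ _ /implyP] := H x.
  by rewrite Exy eqxx lt_xy -Tx led ltnn => /(_ isT).
apply/forallP => y; apply/and4P; split; apply/implyP.
- by case/andP=> /eqP; exact: H1.
- by case/andP=> /eqP; exact: H2.
- case/and4P=> /eqP Exy lt_xy ltx lty; rewrite ltn_neqAle H2 // 1?ltnW // andbT.
  apply/negP => /eqP /(H3 _ _ Exy lt_xy); rewrite nth_pos //.
  by rewrite leqNgt ltx.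
case/and4P=> /eqP Exy lt_xy ltx lty; rewrite ltn_neqAle H1 // 1?ltnW // andbT.
by apply/negP => /eqP /(H4 _ _ Exy lt_xy); rewrite nth_pos // ltx.
Qed.

(** Go along the row of [x] to the column of [y], then down that column; the corner lies in [lam]
    because the parts decrease. *)
Lemma pos_tableau_le (T : sstableau b lam) (x y : box lam) :
  row_of x <= row_of y -> col_of x <= col_of y ->
  pos b (val T x) <= pos b (val T y).
Proof.
move=> ler lec; have [H1 H2 _ _] := semistandardP _ (valP T).
have [|z [rz cz]] := @box_at lam (row_of x) (col_of y) plam.
  by rewrite (leq_trans (col_of_lt y)) // nth_part_le.
by apply: leq_trans (H1 x z _ _) (H2 z y _ _); rewrite ?rz ?cz.
Qed.

Lemma pos_tableau_down (T : sstableau b lam) k (x y : box lam) :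
  row_of x <= row_of y -> col_of x <= col_of y ->
  pos b (val T y) < k -> pos b (val T x) < k.
Proof. by move=> ler lec; apply: leq_ltn_trans; exact: pos_tableau_le. Qed.

Lemma is_part_subshape (T : sstableau b lam) k : is_part (subshape T k).
Proof. exact: (is_part_shape_of plam (@pos_tableau_down T k)). Qed.

Lemma mem_subshape (T : sstableau b lam) k x :
  (col_of x < nth 0 (subshape T k) (row_of x)) = (pos b (val T x) < k).
Proof. exact: (mem_shape_of plam (@pos_tableau_down T k)). Qed.

Lemma subshape_sub (T : sstableau b lam) k i j :
  j < nth 0 (subshape T k) i -> j < nth 0 lam i.
Proof. exact: (shape_of_sub plam (@pos_tableau_down T k)). Qed.

Lemma subshape_size (T : sstableau b lam) : subshape T (size b) = lam.
Proof.
apply: part_ext => // [|i j]; first exact: is_part_subshape.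
apply/idP/idP => [|ltj]; first exact: subshape_sub.
have [x [<- <-]] := box_at plam ltj.
by rewrite mem_subshape pos_letter_lt.
Qed.

(** Otherwise the box [(i, j)] has position at least [k] and its neighbour position at most [k]. By
    monotonicity both are [k], which repeats an epsilon in a row or a delta in a column. *)
Lemma subshape_strip (T : sstableau b lam) k i j :
  (if nth false b k then j.+1 < nth 0 (subshape T k.+1) i
   else j < nth 0 (subshape T k.+1) i.+1) -> j < nth 0 (subshape T k) i.
Proof.
have [_ _ H3 H4] := semistandardP _ (valP T).
(* The neighbour [(i', j')] is on the right for an epsilon and below for a delta, so both cases run
   together. *)
pose i' := if nth false b k then i else i.+1.
pose j' := if nth false b k then j.+1 else j.
have [lei lej] : i <= i' /\ j <= j' by rewrite /i' /j'; case: ifP.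
have -> : (if nth false b k then j.+1 < nth 0 (subshape T k.+1) i
    else j < nth 0 (subshape T k.+1) i.+1) = (j' < nth 0 (subshape T k.+1) i').
  by rewrite /i' /j'; case: ifP.
move=> lty; have [y [ry cy]] := box_at plam (subshape_sub lty).
have [|x [rx cx]] := @box_at lam i j plam.
  by rewrite (leq_ltn_trans lej) // (leq_trans (subshape_sub lty)) // nth_part_le.
move: lty; rewrite -{1}ry -{1}cy -rx -cx !mem_subshape => lty.
have lexy : pos b (val T x) <= pos b (val T y).
  by apply: pos_tableau_le; rewrite ?rx ?ry ?cx ?cy.
rewrite ltnNge; apply/negP => lex.
have Ex : pos b (val T x) = k by apply/eqP; rewrite eqn_leq lex (leq_trans lexy).
have Ey : pos b (val T y) = k by apply/eqP; rewrite eqn_leq -{2}Ex lexy andbT.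
case bk: (nth false b k) @i' @j' ry cy {lei lej} => /= ry cy.
  have := H4 x y; rewrite Ex Ey bk rx ry cx cy.
  by move/(_ erefl (ltnSn _) erefl).
have := H3 x y; rewrite Ex Ey bk rx ry cx cy.
by move/(_ erefl (ltnSn _) erefl).
Qed.

Lemma subshape_mono (T : sstableau b lam) k i j :
  j < nth 0 (subshape T k) i -> j < nth 0 (subshape T k.+1) i.
Proof.
move=> ltj; have [x [rx cx]] := box_at plam (subshape_sub ltj).
by move: ltj; rewrite -rx -cx !mem_subshape => /ltnW.
Qed.

(** A violation is a box whose row and column indices are the numbers of deltas and epsilons.
    [subshape_strip] moves it one step up or left, just as the matching count drops, down to
    [k = 0], where no box is left. *)
Lemma hook_subshape (T : sstableau b lam) k : k <= size b ->
  hook (ndelta (take k b)) (neps (take k b)) (subshape T k).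
Proof.
elim: k => [_|k IHk ltk]; rewrite /hook leqNgt; apply/negP => lth.
  have [x [rx cx]] := box_at plam (subshape_sub lth).
  by move: lth; rewrite -{1}rx -{1}cx mem_subshape.
have := IHk (ltnW ltk); rewrite /hook leqNgt => /negP; apply.
apply: subshape_strip; move: lth; rewrite ndelta_takeS // neps_takeS //.
by case: (nth false b k); rewrite /= ?addn0 ?addn1.
Qed.

Lemma branches_subshape (T : sstableau b lam) k : k < size b ->
  branches (take k.+1 b) (subshape T k.+1) (subshape T k).
Proof.
move=> ltk; apply/branchesP => //; first exact: is_part_subshape.
split; [exact: is_part_subshape| |exact: subshape_mono|exact: subshape_strip].
by apply: hook_subshape; exact: ltnW.
Qed.

(** With [lam] in front, the index counts the letters removed; index 0 is [subshape_size]. *)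
Lemma nth_tableau_chain (T : sstableau b lam) r k : k <= r ->
  nth [::] (lam :: tableau_chain T r) k = subshape T (size b - k).
Proof.
case: k => [|k] ltk /=; first by rewrite subn0 subshape_size.
by rewrite nth_mkseq.
Qed.

Lemma valid_tableau_chain (T : sstableau b lam) r : r <= size b ->
  valid_chain b lam (tableau_chain T r).
Proof.
move=> ler k; rewrite size_mkseq => ltk; rewrite nth_tableau_chain 1?ltnW //.
rewrite nth_mkseq //.
have -> : size b - k = (size b - k.+1).+1 by rewrite subnSK // (leq_trans ltk).
by apply: branches_subshape; rewrite ltn_subrL (leq_ltn_trans _ (leq_trans ltk ler)).
Qed.

(** The shapes tell for each box and each [k] whether its letter sits before position [k], which
    fixes the position and hence the letter. *)
Lemma tableau_chain_inj :
  injective (fun T : sstableau b lam => tableau_chain T (size b)).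
Proof.
move=> T T' E; apply: val_inj; apply/ffunP => x; apply: val_inj.
have lt (U : sstableau b lam) : val U x < size b by rewrite -ndelta_neps.
apply: (@pos_inj b); [exact: lt|exact: lt|].
have shapeE k : k <= size b -> subshape T k = subshape T' k.
  move=> lek; have := congr1 (fun c => nth [::] (lam :: c) (size b - k)) E.
  by rewrite !nth_tableau_chain ?leq_subr // subKn.
have ltE k : k <= size b -> (pos b (val T x) < k) = (pos b (val T' x) < k).
  by move=> lek; rewrite -!mem_subshape shapeE.
(* Each position is tested against the threshold one above the other. *)
apply/eqP; rewrite eqn_leq -ltnS ltE ?pos_letter_lt // ltnSn /=.
by rewrite -ltnS -ltE ?pos_letter_lt // ltnSn.
Qed.

End Tableau.

(** * The tableau of a full chain *)

Section TableauOfChain.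
Variables (b : seq bool) (lam : seq nat) (c : seq (seq nat)).
Hypotheses (plam : is_part lam) (hlam : hook (ndelta b) (neps b) lam).
Hypotheses (vc : valid_chain b lam c) (sc : size c = size b).

(** Indexed by the number of letters that remain, to match [subshape T k]; the chain counts removed
    letters instead. *)
Let shape k := nth [::] (lam :: c) (size b - k).

Let shape_size : shape (size b) = lam.
Proof. by rewrite /shape subnn. Qed.

Let branches_shape k : k < size b ->
  branches (take k.+1 b) (shape k.+1) (shape k).
Proof.
move=> ltk; have ltc : size b - k.+1 < size c.
  by rewrite sc ltn_subrL (leq_ltn_trans _ ltk).
by have := vc ltc; rewrite subKn // /shape -[size b - k]subnSK.
Qed.

Let shape_part k : k <= size b -> is_part (shape k).
Proof.
rewrite leq_eqVlt => /orP[/eqP->|/branches_shape[]//].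
by rewrite shape_size.
Qed.

Let shapeP k (ltk : k < size b) :=
  (branchesP (shape k) ltk (shape_part ltk)).1 (branches_shape ltk).

(** The hook condition for gl(0|0) leaves only the empty diagram; if [b] is empty, that condition is
    the hypothesis on [lam]. *)
Let shape0 i j : (j < nth 0 (shape 0) i) = false.
Proof.
have hook0 : hook 0 0 (shape 0).
  case: (posnP (size b)) => [b0|/shapeP[_]]; last by rewrite take0.
  by move: hlam; rewrite -shape_size b0; case: b b0.
apply/negbTE; rewrite -leqNgt (leq_trans _ (leq0n _)) //.
exact: leq_trans (nth_part_le (shape_part (leq0n _)) (leq0n i)) hook0.
Qed.

Let shape_le k l i j : k <= l -> l <= size b ->
  j < nth 0 (shape k) i -> j < nth 0 (shape l) i.
Proof.
elim: l => [|l IHl]; first by rewrite leqn0 => /eqP->.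
rewrite leq_eqVlt => /orP[/eqP->//|lekl ltl ltj].
by have [_ _ H _] := shapeP ltl; apply/H/IHl => //; exact: ltnW.
Qed.

Let shape_down k i j i' j' : k <= size b -> i <= i' -> j <= j' ->
  j' < nth 0 (shape k) i' -> j < nth 0 (shape k) i.
Proof.
move=> lek lei lej /(leq_ltn_trans lej) /leq_trans -> //.
by apply: nth_part_le lei; exact: shape_part.
Qed.

(** The least index whose shape contains [x] is positive by [shape0]; the letter is the one at the
    position just before it. *)
Let letter (x : box lam) : {a : 'I_(ndelta b + neps b) |
  forall k, k <= size b ->
    (pos b a < k) = (col_of x < nth 0 (shape k) (row_of x))}.
Proof.
have exk : exists k, (k <= size b) && (col_of x < nth 0 (shape k) (row_of x)).
  by exists (size b); rewrite leqnn shape_size; exact: col_of_lt.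
case: (ex_minnP exk) => -[|k] /andP[ltk inx] mink.
  by move: inx; rewrite shape0.
have [a lta posa] := cid2 (pos_surj ltk).
have lta' : a < ndelta b + neps b by rewrite ndelta_neps.
exists (Ordinal lta') => l lel /=; rewrite posa; apply/idP/idP => [ltkl|inl].
  exact: shape_le ltkl lel inx.
by apply: mink; rewrite lel.
Qed.

Let T : filling b lam := [ffun x => sval (letter x)].

Let pos_T x k : k <= size b ->
  (pos b (T x) < k) = (col_of x < nth 0 (shape k) (row_of x)).
Proof. by move=> lek; rewrite ffunE (svalP (letter x)). Qed.

Let pos_T_le (x y : box lam) : row_of x <= row_of y -> col_of x <= col_of y ->
  pos b (T x) <= pos b (T y).
Proof.
move=> ler lec; rewrite -ltnS pos_T ?pos_letter_lt //.
by apply: shape_down ler lec _; rewrite -?pos_T ?pos_letter_lt.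
Qed.

(** For equal letters at position [p], the later box lies in [shape p.+1]. A forbidden repetition
    would let the strip condition put [x] into [shape p], that is [p < p]. *)
Let semistandard_T : semistandard T.
Proof.
apply/semistandardP; split=> x y.
- by move=> Er; apply: pos_T_le; rewrite Er.
- by move=> Ec ler; apply: pos_T_le; rewrite ?Ec.
- move=> Ec ltr Epos; have ltx := pos_letter_lt (T x).
  have [_ _ _ H] := shapeP ltx; apply/negPn/negP => /negbTE bx.
  have := ltnn (pos b (T x)); rewrite pos_T ?(ltnW ltx) //.
  rewrite H // bx; apply: (shape_down ltx ltr (leqnn _)).
  by rewrite Ec -pos_T // Epos.
move=> Er ltc Epos; have ltx := pos_letter_lt (T x).
have [_ _ _ H] := shapeP ltx; apply/negP => bx.
have := ltnn (pos b (T x)); rewrite pos_T ?(ltnW ltx) //.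
rewrite H // bx; apply: (shape_down ltx (leqnn _) ltc).
by rewrite Er -pos_T // Epos.
Qed.

Lemma tableau_chain_surj :
  exists T : sstableau b lam, tableau_chain T (size b) = c.
Proof.
pose T' : sstableau b lam :=
  exist (fun T : filling b lam => semistandard T) T semistandard_T.
exists T'; apply: (@eq_from_nth _ [::]); rewrite size_mkseq //.
move=> i lti; rewrite nth_mkseq //.
have -> : nth [::] c i = shape (size b - i.+1) by rewrite /shape subKn.
have le_size := leq_subr i.+1 (size b).
apply: part_ext => [||k j]; [exact: is_part_subshape|exact: shape_part|].
have inE (x : box lam) :
    (col_of x < nth 0 (subshape T' (size b - i.+1)) (row_of x))
    = (col_of x < nth 0 (shape (size b - i.+1)) (row_of x)).
  by rewrite mem_subshape // pos_T.
apply/idP/idP => ltj.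
  have [x [rx cx]] := box_at plam (subshape_sub plam ltj).
  by rewrite -rx -cx -inE rx cx.
have := shape_le le_size (leqnn _) ltj.
rewrite shape_size => /(box_at plam)[x [rx cx]].
by rewrite -rx -cx inE rx cx.
Qed.

End TableauOfChain.

(** * Direct sums *)

Lemma big_partition_seq (V : nmodType) (I J : eqType) (p : I -> J) (s : seq I)
    (u : I -> V) :
  (\sum_(i <- s) u i = \sum_(j <- undup (map p s)) \sum_(i <- s | p i == j) u i)%R.
Proof.
rewrite (exchange_big_dep xpredT) //=; apply: eq_big_seq => i si.
rewrite (eq_bigl (pred1 (p i))) => [|j]; last by rewrite /= eq_sym.
by rewrite -big_filter filter_pred1_uniq ?undup_uniq ?mem_undup ?map_f // big_seq1.
Qed.

Section DirectSums.
Local Open Scope classical_set_scope.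
Local Open Scope ring_scope.
Variables (R : realType) (V : lmodType R[i]).
Implicit Types (U W : set V).

Lemma subspace_sum U (I : eqType) (s : seq I) (P : pred I) (u : I -> V) :
  subspace U -> (forall i, i \in s -> P i -> U (u i)) -> U (\sum_(i <- s | P i) u i).
Proof.
case=> U0 UD; elim: s => [|i s IHs] Uu; first by rewrite big_nil.
have Us : U (\sum_(j <- s | P j) u j).
  by apply: IHs => j sj; apply: Uu; rewrite inE sj orbT.
rewrite big_cons; case: ifP => // Pi.
by rewrite -[u i]scale1r; apply: UD => //; apply: Uu; rewrite // mem_head.
Qed.

Lemma direct_sum_single (I : eqType) (i0 : I) (U : I -> set V) :
  U i0 0 -> direct_sum [set i0] U (U i0).
Proof.
move=> U0; split=> [i ->|w Uw|s u us Us] //.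
  exists [:: i0], (fun=> w); split=> [|i|] //; last by rewrite big_seq1.
  by rewrite inE => /eqP ->.
move=> s0 i si; have [Ei _] := Us i si; move: s0; rewrite (bigD1_seq i) //=.
rewrite big1_seq ?addr0 // => j /andP[ji sj].
by have [Ej _] := Us j sj; rewrite Ei Ej eqxx in ji.
Qed.

(** Direct sums compose. For independence, a zero sum is grouped by parent chain: the outer sum
    kills each group, then the inner sum kills each term. *)
Lemma direct_sum_rcons (I : eqType) (D : set (seq I)) (E : seq I -> set I)
    (U : seq I -> set V) W :
  (forall c, D c -> subspace (U c)) ->
  direct_sum D U W ->
  (forall c, D c -> direct_sum (E c) (fun i => U (rcons c i)) (U c)) ->
  direct_sum [set d | exists c i, [/\ D c, E c i & d = rcons c i]] U W.
Proof.
move=> subU [UW Wsum Wind] H; split.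
- move=> _ [c [i [Dc Ei ->]]] v Uv; apply: (UW c Dc).
  by have [sub _ _] := H c Dc; exact: sub Ei _ Uv.
- move=> w /Wsum[s [u [us Us ->]]].
  have /choice[t tP] : forall c, exists t : seq I * (I -> V), c \in s ->
      [/\ uniq t.1, forall i, i \in t.1 -> E c i /\ U (rcons c i) (t.2 i)
        & u c = \sum_(i <- t.1) t.2 i].
    move=> c; case: (boolP (c \in s)) => [sc|]; last by exists ([::], fun=> 0).
    have [Dc Uc] := Us c sc; have [_ sum _] := H c Dc.
    by have [t1 [t2 tP]] := sum _ Uc; exists (t1, t2).
  exists [seq rcons c i | c <- s, i <- (t c).1].
  (* [belast] and [last] recover [c] and [i] from [rcons c i]; 0 is a default at the empty chain. *)
  exists (fun d => if d is x :: d' then (t (belast x d')).2 (last x d') else 0).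
  split.
  + apply: allpairs_uniq_dep => // [c sc|]; first by have [] := tP c sc.
    by move=> [c i] [c' i'] _ _ /= /rcons_inj[-> ->].
  + move=> _ /allpairsPdep[c [i [sc ti ->]]].
    have [Dc _] := Us c sc; have [_ tE _] := tP c sc; have [Ei Ui] := tE i ti.
    split; first by exists c, i.
    case: c sc ti Dc Ei Ui {tE} => [|x c] //= _ _ _ _.
    by rewrite last_rcons belast_rcons.
  rewrite big_allpairs_dep; apply: eq_big_seq => c sc.
  have [_ _ ->] := tP c sc; apply: eq_bigr => i _.
  by case: c {sc} => [|x c] //=; rewrite last_rcons belast_rcons.
move=> s u us Us s0 d sd.
have Us' e : e \in s -> exists c i, [/\ D c, E c i, e = rcons c i & U e (u e)].
  by move=> /Us[[c [i [Dc Ei ->]]] Ue]; exists c, i.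
(* [p] drops the last entry, sending a chain to its parent. *)
pose p (e : seq I) := rev (behead (rev e)).
have pE c i : p (rcons c i) = c by rewrite /p rev_rcons /= revK.
have U_p e : e \in s -> D (p e) /\ U (p e) (u e).
  move=> /Us'[c [i [Dc Ei -> Ue]]]; rewrite pE; split=> //.
  by have [sub _ _] := H c Dc; exact: sub Ei _ Ue.
have [c [i [Dc Ei ed _]]] := Us' d sd.
have sum_c0 : \sum_(e <- s | p e == c) u e = 0.
  apply: (Wind (undup (map p s)) (fun c => \sum_(e <- s | p e == c) u e)).
  - exact: undup_uniq.
  - move=> c'; rewrite mem_undup => /mapP[e se ->]; have [De _] := U_p e se.
    split=> //; apply: subspace_sum; first exact: subU.
    by move=> e' /U_p[_ Ue'] /eqP <-.
  - by rewrite -big_partition_seq.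
  - by rewrite mem_undup; apply/mapP; exists d; rewrite // ed pE.
have [_ _ ind] := H c Dc.
(* The last entries of the chains in [s] with parent [c]. *)
pose t := [seq j <- undup (map (last i) s) | rcons c j \in s].
rewrite ed; apply: (ind t (fun j => u (rcons c j))).
- by rewrite filter_uniq // undup_uniq.
- move=> j; rewrite mem_filter => /andP[sj _].
  have [c' [j' [_ Ej' /rcons_inj[-> ->] Uj]]] := Us' _ sj; split=> //.
- rewrite -[RHS]sum_c0 -[RHS]big_filter -(big_map (rcons c) xpredT u).
  apply: perm_big; apply: uniq_perm => [||e].
  + by rewrite map_inj_uniq ?filter_uniq ?undup_uniq // => j j' /rcons_inj[].
  + by rewrite filter_uniq.
  rewrite mem_filter; apply/mapP/andP => [[j]|[/eqP pe se]].
    by rewrite mem_filter => /andP[sj _] ->; rewrite pE.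
  have [c' [j [_ _ ee _]]] := Us' e se; rewrite ee pE in pe; rewrite pe in ee.
  exists j => //; rewrite mem_filter -ee se mem_undup.
  by apply/mapP; exists e; rewrite // ee last_rcons.
rewrite mem_filter -ed sd mem_undup.
by apply/mapP; exists d; rewrite // ed last_rcons.
Qed.

Lemma direct_sum_image (V' : lmodType R[i]) (f : {linear V' -> V}) (I : eqType)
    (D : set I) (U : I -> set V') (W : set V') :
  injective f -> direct_sum D U W ->
  direct_sum D (fun i => f @` U i) (f @` W).
Proof.
move=> f_inj [UW Wsum Wind]; split.
- by move=> i Di _ [v Uv <-]; exists v => //; exact: UW Di _ Uv.
- move=> _ [w /Wsum[s [u [us Us ->]]] <-]; exists s, (f \o u); split=> //.
    by move=> i /Us[Di Ui]; split=> //; exists (u i).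
  by rewrite linear_sum.
move=> s u us Us s0.
have /choice[t tP] : forall i, exists v, i \in s -> U i v /\ f v = u i.
  move=> i; case: (boolP (i \in s)) => [/Us[_ [v Uv fv]]|_]; last by exists 0.
  by exists v.
have t0 : \sum_(i <- s) t i = 0.
  apply: f_inj; rewrite linear_sum linear0 -[RHS]s0; apply: eq_big_seq => i si.
  by have [] := tP i si.
move=> i si; have [_ <-] := tP i si; rewrite (Wind s t us _ t0 i si) ?linear0 //.
by move=> j sj; have [Dj _] := Us j sj; have [Uj _] := tP j sj.
Qed.

(** Through the bijection [h] from [T] to [D], the component of a vector in each line is a unique
    multiple of the chosen generator. *)
Lemma is_basis_lines (T : finType) (I : eqType) (D : set I) (U : I -> set V)
    (h : T -> I) (v : T -> V) :
  injective h -> (forall i, D i <-> exists t, h t = i) ->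
  direct_sum D U setT ->
  (forall t, v t != 0 /\ U (h t) = [set w | exists k : R[i], w = k *: v t]) ->
  is_basis v.
Proof.
move=> h_inj hD [_ Wsum Wind] Uv w.
have Dh t : D (h t) by apply/hD; exists t.
have indep (k : T -> R[i]) : \sum_t k t *: v t = 0 -> forall t, k t = 0.
  (* The terms are reindexed by [I]; each nonempty fibre of [h] is a single point, so [u (h t')] is
     one term. *)
  move=> sum0 t; pose u i := \sum_(t' | h t' == i) k t' *: v t'.
  have uh t' : u (h t') = k t' *: v t'.
    by rewrite /u (big_pred1 t') // => t''; rewrite /= (inj_eq h_inj).
  have : u (h t) = 0.
    apply: (Wind (map h (enum T))).
    - by rewrite map_inj_uniq // enum_uniq.
    - move=> _ /mapP[t' _ ->]; split=> //; have [_ ->] := Uv t'.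
      by exists (k t'); rewrite uh.
    - rewrite big_map -[RHS]sum0 big_enum /=.
      by apply: eq_bigr => t' _; rewrite uh.
    - by rewrite map_f // mem_enum.
  have [v0 _] := Uv t.
  by rewrite uh => /eqP; rewrite scaler_eq0 (negPf v0) orbF => /eqP.
have [s [u [us Us ->]]] := Wsum w Logic.I.
(* Lines absent from [s] get component 0. *)
have /choice[k kP] : forall t, exists k : R[i],
    (if h t \in s then u (h t) else 0) = k *: v t.
  move=> t; case: ifP => [/Us[_]|_]; last by exists 0; rewrite scale0r.
  by have [_ ->] := Uv t.
have sumk : \sum_(i <- s) u i = \sum_t k t *: v t.
  have -> : \sum_t k t *: v t = \sum_t (if h t \in s then u (h t) else 0).
    by apply: eq_bigr => t _; rewrite kP.
  rewrite -big_mkcond -[RHS]big_filter -(big_map h xpredT u).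
  apply: perm_big; apply: uniq_perm => // [|i].
    by rewrite map_inj_uniq // filter_uniq // index_enum_uniq.
  apply/idP/mapP => [si|[t]]; last by rewrite mem_filter => /andP[st _] ->.
  have [/hD[t ht] _] := Us i si.
  by exists t; rewrite // mem_filter ht si mem_index_enum.
exists [ffun t => k t]; split.
  by rewrite sumk; apply: eq_bigr => t _; rewrite ffunE.
move=> k' sumk'; apply/ffunP => t; rewrite ffunE; apply/eqP; rewrite -subr_eq0.
apply/eqP; apply: (indep (fun t => k t - k' t)).
under eq_bigr do rewrite scalerBl.
by rewrite sumrB -sumk -sumk' subrr.
Qed.

End DirectSums.

(** * Modules *)

Section Modules.
Local Open Scope classical_set_scope.
Local Open Scope ring_scope.
Variable R : realType.

(** The only matrix of size 0 is zero and acts by zero, so every line is stable. Submodules are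
    graded, hence the line is spanned by a nonzero homogeneous component of some nonzero vector. *)
Lemma glmodule00_line (L : glmodule R 0 0) : simple_module L ->
  exists2 v : L, v != 0 & forall w, exists k : R[i], w = k *: v.
Proof.
case=> -[v v0 simpleL].
have [s [u [u0 hu]]] : exists s (u : L), u != 0 /\ homog s u.
  have [[u0 u1] [[/= h0 h1 vE] _]] := homog_split v.
  have [u00|] := eqVneq u0 0; last by exists false, u0.
  by exists true, u1; split=> //; rewrite vE u00 add0r in v0.
have homZ t (k : R[i]) (x : L) : homog t x -> homog t (k *: x).
  have [h0 hD] := homog_subspace L t; move=> hx.
  by rewrite -[k *: x]addr0; exact: hD.
have [h00 _] := homog_subspace L false; have [h01 _] := homog_subspace L true.
exists u => // w.
have : submodule [set w : L | exists k : R[i], w = k *: u].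
  split.
  - split=> [|k _ _ [k1 ->] [k2 ->]]; first by exists 0; rewrite scale0r.
    by exists (k * k1 + k2); rewrite scalerDl scalerA.
  - move=> _ [k ->].
    have U0 : exists k : R[i], 0 = k *: u by exists 0; rewrite scale0r.
    have Uk : exists k' : R[i], k *: u = k' *: u by exists k.
    case: s hu => hu; [exists 0, (k *: u)|exists (k *: u), 0].
      by split; rewrite ?add0r //; exact: homZ.
    by split; rewrite ?addr0 //; exact: homZ.
  move=> X x _; exists 0; rewrite scale0r.
  have -> : X = 0 by exact: flatmx0.
  (* Linearity at [-1 *: 0 + 0] gives [act 0 x = - act 0 x + act 0 x]. *)
  by have /= := act_linearl x (-1) 0 0; rewrite scaler0 addr0 scaleN1r addNr.
case/simpleL => E.
  have : [set w : L | exists k : R[i], w = k *: u] u by exists 1; rewrite scale1r.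
  by rewrite E => /eqP; rewrite (negPf u0).
by have : setT w by []; rewrite -E.
Qed.

Lemma gl_emb_id m n (X : 'M[R[i]]_(m + n)) : gl_emb m n X = X.
Proof.
rewrite /gl_emb /gl_incl !pid_mx_1 -scalar_mx_block trmx1.
by rewrite mul1mx mulmx1.
Qed.

(** Products of partial identities are partial identities of the smaller rank. Restriction in stages
    thus agrees with direct restriction from gl(m|n), to which [is_L_sub] refers. *)
Lemma gl_emb_comp p q p' q' m n (X : 'M[R[i]]_(p' + q')) :
  (p' <= p)%N -> (q' <= q)%N ->
  gl_emb m n (gl_emb p q X) = gl_emb m n X.
Proof.
move=> lep leq; have inclE : gl_incl R p q m n *m gl_incl R p' q' p q
    = gl_incl R p' q' m n.
  rewrite /gl_incl mulmx_block !mulmx0 !mul0mx !addr0 add0r !mul_pid_mx.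
  by rewrite (minn_idPr lep) (minn_idPr leq) (minn_idPr lep) (minn_idPr leq).
by rewrite /gl_emb -inclE trmx_mul !mulmxA.
Qed.

Section Summands.
Variables (m n : nat) (M : glmodule R m n).

Lemma is_L_sub_subspace b mu (U : set M) : is_L_sub b mu U -> subspace U.
Proof.
case=> L [_ [f [[lf _ _] _ <-]]].
pose fL : {linear L -> M} := HB.pack f (GRing.isLinear.Build _ _ _ _ f lf).
split; first by exists 0 => //; exact: (linear0 fL).
move=> k _ _ [u _ <-] [v _ <-]; exists (k *: u + v) => //; exact: (linearP fL).
Qed.

Lemma is_L_sub_nil_line mu (U : set M) : is_L_sub [::] mu U ->
  exists2 v, v != 0 & U = [set w | exists k : R[i], w = k *: v].
Proof.
case=> L [[simpleL _] [f [[lf _ _] f_inj <-]]].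
pose fL : {linear L -> M} := HB.pack f (GRing.isLinear.Build _ _ _ _ f lf).
have [v v0 spanv] := glmodule00_line simpleL.
exists (f v).
  by apply: contraNneq v0 => fv0; apply/eqP/f_inj; rewrite fv0; exact/esym/(linear0 fL).
apply/seteqP; split=> [_ [w _ <-]|_ [k ->]].
  by have [k ->] := spanv w; exists k; exact: (linearZZ fL).
by exists (k *: v) => //; exact: (linearZZ fL).
Qed.

Lemma is_L_sub_comp b b' mu (L : glmodule R (ndelta b) (neps b)) (f : L -> M)
    (U : set L) :
  (ndelta b' <= ndelta b)%N -> (neps b' <= neps b)%N ->
  res_hom f -> injective f -> is_L_sub b' mu U -> is_L_sub b' mu (f @` U).
Proof.
move=> led lee [lf hf af] f_inj [L' [HL' [g [[lg hg ag] g_inj <-]]]].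
exists L'; split=> //; exists (f \o g); split; last by rewrite image_comp.
  split=> [k u v|s x /hg /hf//|X x] /=; first by rewrite lg lf.
  by rewrite ag af gl_emb_comp.
exact: inj_comp.
Qed.

(** The rule is stated for a whole module, while iteration applies it to a summand [W] inside
    [M]. *)
Lemma branching_is_L_sub b mu (W : set M) : branching_rule R ->
  (0 < size b)%N -> is_part mu -> hook (ndelta b) (neps b) mu ->
  is_L_sub b mu W -> exists U, branching_decomposition b mu U W.
Proof.
move=> Hbranch b_gt0 pmu hmu [L [HL [f [rf f_inj <-]]]].
have [U [sumU HU]] := Hbranch b mu L b_gt0 pmu hmu HL.
have [lf _ _] := rf.
pose fL : {linear L -> M} := HB.pack f (GRing.isLinear.Build _ _ _ _ f lf).
exists (fun sigma => f @` U sigma); split.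
  exact: (direct_sum_image (f := fL) f_inj sumU).
have le_count (a : pred bool) : (count a (trunc b) <= count a b)%N.
  by rewrite -[in leqRHS](cat_take_drop (size b).-1 b) count_cat leq_addr.
by move=> sigma Hsigma; apply: is_L_sub_comp (HU _ Hsigma); rewrite ?le_count.
Qed.

End Summands.

Lemma is_L_sub_setT b lam (M : glmodule R (ndelta b) (neps b)) :
  is_L b (hwt b lam) M -> is_L_sub b lam [set: M].
Proof.
move=> HM; exists M; split=> //; exists id; split=> //; last exact: image_id.
by split=> // X x; rewrite gl_emb_id.
Qed.

End Modules.

(** * Chains of summands and the iterated decomposition *)

Section Chains.
Local Open Scope classical_set_scope.
Local Open Scope ring_scope.
Variables (R : realType) (b : seq bool) (lam : seq nat).

Lemma valid_chain_rcons c sigma : valid_chain b lam (rcons c sigma) <->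
  valid_chain b lam c /\ branches (take (size b - size c) b) (last lam c) sigma.
Proof.
have lastE : last lam c = nth [::] (lam :: c) (size c).
  by rewrite (nth_last [::] (lam :: c)).
have nthE r : (r <= size c)%N ->
    nth [::] (lam :: rcons c sigma) r = nth [::] (lam :: c) r.
  by move=> ler; rewrite -rcons_cons nth_rcons /= ltnS ler.
split=> [vc|[vc Hsigma] r].
  split=> [r ltr|].
    have := vc r; rewrite size_rcons nthE ?(ltnW ltr) // nth_rcons ltr.
    by apply; rewrite ltnW.
  have := vc (size c); rewrite size_rcons nthE // nth_rcons ltnn eqxx lastE.
  by apply.
rewrite size_rcons ltnS => ler; rewrite nthE // nth_rcons.
have [ltr|ger] := ltnP r (size c); first exact: vc.
have -> : r = size c by apply/eqP; rewrite eqn_leq ler ger.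
by rewrite eqxx -lastE.
Qed.

Hypotheses (plam : is_part lam) (hlam : hook (ndelta b) (neps b) lam).

(** Membership in the last index set provides what the rule asks for at the next step; for the empty
    chain the hypotheses on [lam] do. *)
Lemma last_valid_chain c : valid_chain b lam c -> (size c <= size b)%N ->
  let b' := take (size b - size c) b in
  is_part (last lam c) /\ hook (ndelta b') (neps b') (last lam c).
Proof.
case/lastP: c => [|c sigma]; first by rewrite /= subn0 take_size.
case/valid_chain_rcons=> _ [psigma hsigma _ _]; rewrite size_rcons last_rcons.
move=> ltc; split=> //; move: hsigma.
by rewrite trunc_take_sub.
Qed.

Variable M : glmodule R (ndelta b) (neps b).
Hypothesis HM : is_L b (hwt b lam) M.

Lemma iterated_branching_is_L_sub U c : iterated_branching b lam M U ->
  valid_chain b lam c -> (size c <= size b)%N ->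
  is_L_sub (take (size b - size c) b) (last lam c) (U c).
Proof.
case=> UT HU; case/lastP: c => [|c sigma].
  by rewrite /= subn0 take_size UT => _ _; exact: is_L_sub_setT.
case/valid_chain_rcons=> vc Hsigma; rewrite size_rcons last_rcons => ltc.
have [_ /(_ _ Hsigma)] := HU c vc ltc.
by rewrite trunc_take_sub.
Qed.

(** Decompositions are chosen once for all triples of a sequence, a partition and a subset; folding
    the choice along a chain then defines [U c]. *)
Lemma exists_iterated_branching : branching_rule R ->
  exists U, iterated_branching b lam M U.
Proof.
move=> Hbranch.
have /choice[F FP] : forall x : seq bool * seq nat * set M,
    exists U : seq nat -> set M, (0 < size x.1.1)%N -> is_part x.1.2 ->
      hook (ndelta x.1.1) (neps x.1.1) x.1.2 -> is_L_sub x.1.1 x.1.2 x.2 ->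
      branching_decomposition x.1.1 x.1.2 U x.2.
  move=> [[b' mu] W] /=; have [H|nH] := pselect [/\ (0 < size b')%N, is_part mu,
      hook (ndelta b') (neps b') mu & is_L_sub b' mu W].
    case: H => b'_gt0 pmu hmu /(branching_is_L_sub Hbranch b'_gt0 pmu hmu).
    by case=> U HU; exists U.
  by exists (fun=> setT) => *; case: nH.
pose step (x : seq bool * seq nat * set M) sigma := (trunc x.1.1, sigma, F x sigma).
pose state c := foldl step (b, lam, setT) c.
have state_rcons c sigma : state (rcons c sigma) = step (state c) sigma.
  by rewrite /state -cats1 foldl_cat.
(* Invariant: along a valid chain the state holds the truncated sequence, the last partition and a
   summand of the matching type. *)
have stateE c : valid_chain b lam c -> (size c <= size b)%N ->
    state c = (take (size b - size c) b, last lam c, (state c).2)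
    /\ is_L_sub (take (size b - size c) b) (last lam c) (state c).2.
  elim/last_ind: c => [_ _|c sigma IHc].
    by rewrite /= subn0 take_size; split=> //; exact: is_L_sub_setT.
  case/valid_chain_rcons=> vc Hsigma; rewrite size_rcons last_rcons => ltc.
  have [cE HLc] := IHc vc (ltnW ltc); have [pc hc] := last_valid_chain vc (ltnW ltc).
  have bE := trunc_take_sub ltc.
  rewrite state_rcons /step /= cE /= bE; split=> //.
  have sz : (0 < size (take (size b - size c) b))%N.
    by rewrite size_takel ?leq_subr // subn_gt0.
  have [_ /(_ _ Hsigma)] := FP (_, _, _) sz pc hc HLc.
  by rewrite bE.
exists (fun c => (state c).2); split=> // c vc ltc.
have [cE HLc] := stateE c vc (ltnW ltc); have [pc hc] := last_valid_chain vc (ltnW ltc).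
have -> : (fun sigma => (state (rcons c sigma)).2)
    = F (take (size b - size c) b, last lam c, (state c).2).
  by apply/funext => sigma; rewrite state_rcons /= -cE.
apply: (FP (_, _, _)) => //=.
by rewrite size_takel ?leq_subr // subn_gt0.
Qed.

(** Start from the one-term sum [M] and refine every summand once per step by [direct_sum_rcons]. *)
Lemma direct_sum_chains U r : iterated_branching b lam M U -> (r <= size b)%N ->
  direct_sum [set c | valid_chain b lam c /\ size c = r] U setT.
Proof.
move=> HU; elim: r => [_|r IHr ltr].
  have [UT _] := HU; rewrite -UT.
  have -> : [set c | valid_chain b lam c /\ size c = 0%N] = [set [::]].
    by apply/seteqP; split=> [c [_ /size0nil]|_ ->].
  by apply: direct_sum_single; rewrite UT.
have -> : [set c | valid_chain b lam c /\ size c = r.+1] =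
    [set d | exists c sigma,
       [/\ [set c | valid_chain b lam c /\ size c = r] c,
         branches (take (size b - size c) b) (last lam c) sigma
         & d = rcons c sigma]].
  apply/seteqP; split=> [d [vd sd]|_ [c [sigma [[vc sc] Hsigma ->]]]].
    case/lastP: d vd sd => // c sigma /valid_chain_rcons[vc Hsigma].
    by rewrite size_rcons => -[sc]; exists c, sigma.
  by rewrite /= size_rcons sc; split=> //; apply/valid_chain_rcons.
pose E c := branches (take (size b - size c) b) (last lam c).
apply: (direct_sum_rcons (E := E)).
- move=> c [vc sc]; apply: (@is_L_sub_subspace R _ _ M).
  by apply: (iterated_branching_is_L_sub HU vc); rewrite sc ltnW.
- exact/IHr/ltnW.
by move=> c [vc sc]; have [_ /(_ c vc)] := HU; rewrite {1}sc => /(_ ltr)[].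
Qed.

Lemma iterated_branching_sub U c k : iterated_branching b lam M U ->
  valid_chain b lam c -> (size c <= size b)%N -> U c `<=` U (take k c).
Proof.
move=> HU; elim/last_ind: c k => [|c sigma IHc] k; first by move=> _ _ w.
move=> vd; have [vc Hsigma] := (valid_chain_rcons c sigma).1 vd.
rewrite size_rcons => ltc; have [lek|gtk] := leqP k (size c); last first.
  by rewrite take_oversize // size_rcons.
rewrite -cats1 takel_cat // cats1; apply: subset_trans (IHc k vc (ltnW ltc)).
by have [_ /(_ c vc ltc)[[sub _ _] _]] := HU; exact: sub.
Qed.

End Chains.

Theorem proposition3p2p1 (R : realType) (Hbranch : branching_rule R)
    (b : seq bool) (lam : seq nat)
    (Hlam : is_part lam) (Hhook : hook (ndelta b) (neps b) lam)
    (M : glmodule R (ndelta b) (neps b)) (HM : is_L b (hwt b lam) M) :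
  (exists U : seq (seq nat) -> set M, iterated_branching b lam M U) /\
  (forall U : seq (seq nat) -> set M, iterated_branching b lam M U ->
     exists v : sstableau b lam -> M,
       is_basis v /\
       forall (T : sstableau b lam) (r : nat), r <= size b ->
         U (tableau_chain T r) (v T)).
Proof.
split=> [|U HU]; first exact: exists_iterated_branching.
pose h (T : sstableau b lam) := tableau_chain T (size b).
have size_h T : size (h T) = size b by rewrite size_mkseq.
have vh T : valid_chain b lam (h T) by exact: valid_tableau_chain.
(* After [size b] steps the sequence is empty, so the summand is a line; [v T] is a generator of
   it. *)
have /choice[v vP] : forall T, exists v : M,
    v != 0%R /\ U (h T) = [set w | exists k : R[i], w = k *: v]%R%classic.
  move=> T; have := iterated_branching_is_L_sub HM HU (vh T) (eq_leq (size_h T)).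
  rewrite size_h subnn take0 => /is_L_sub_nil_line[v v0 ->].
  by exists v.
exists v; split=> [|T r ler].
  have sumU := direct_sum_chains HM HU (leqnn _).
  apply: (is_basis_lines (tableau_chain_inj Hlam) _ sumU vP).
  move=> c; split=> [[vc sc]|[T <-]]; last by split; [exact: vh|exact: size_h].
  exact: tableau_chain_surj.
(* The shorter chain is a prefix of the full one, so its summand contains the line of [v T]. *)
have -> : tableau_chain T r = take r (h T).
  by rewrite /h /tableau_chain /mkseq -map_take take_iota (minn_idPl ler).
apply: (iterated_branching_sub r HU (vh T) (eq_leq (size_h T))).
by have [_ ->] := vP T; exists 1%R; rewrite scale1r.
Qed.
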